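(* Let $X$ be a locally compact Hausdorff space, let $E$ be a monotone complete partially ordered vector space, and let $\pi\colon C_c(X)\to E$ be a positive operator. Suppose that $\mu\colon\mathscr B\to\overline{E^+}$ is a regular Borel measure such that $\pi(f)=\int_X^{o}f\,d\mu$ for $f\in C_c(X)$; $\mu(V)=\bigvee\{\pi(f):f\prec V\}$ in $E^+$ for every open subset $V$ of $X$ with finite measure; and $\mu(K)=\bigwedge\{\pi(f):K\prec f\}$ in $E^+$ for every compact subset $K$ of $X$. Then $$I_\mu(\mathcal L^1(X,\mathscr B,\mu;\mathbb R^+))\subseteq[\pi(C_c(X)^+)]^{\Uparrow\Downarrow\uparrow};$$ if $\mu$ is inner regular at all Borel subsets of $X$ with finite measure, then also $$I_\mu(\mathcal L^1(X,\mathscr B,\mu;\mathbb R^+))\subseteq[\pi(C_c(X)^+)]^{\Downarrow\Uparrow\uparrow}.$$ Suppose that $\mu$ is finite. Then $$I_\mu(\mathcal B(X,\mathscr B;\mathbb R^+))\subseteq[\pi(C_c(X)^+)]^{\Uparrow\Downarrow\downarrow};$$ if $\mu$ is inner regular at all Borel subsets of $X$, then also $$I_\mu(\mathcal B(X,\mathscr B;\mathbb R^+))\subseteq[\pi(C_c(X)^+)]^{\Downarrow\Uparrow\downarrow}.$$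
   Context: All vector spaces are over $\mathbb R$; $\mathbb R^+=[0,\infty)$. A partially ordered vector space $E$ has a proper (not necessarily generating) positive cone $E^+$ and is always supposed to be Archimedean. $x_\lambda\uparrow x$ (resp. $x_\lambda\downarrow x$) means that $(x_\lambda)$ is an increasing (resp. decreasing) net with supremum (resp. infimum) $x$. $E$ is monotone complete if every increasing net that is bounded above has a supremum. $\overline E=E\cup\{\infty\}$ with $\infty$ as largest element, and $\overline{E^+}=E^+\cup\{\infty\}$ with the obvious addition and action of $\mathbb R^+$. $\mathscr B$ is the Borel $\sigma$-algebra of $X$ (generated by the open sets). A measure $\mu\colon\mathscr B\to\overline{E^+}$ is a map with $\mu(\emptyset)=0$ and $\mu(\bigcup_n\Delta_n)=\bigvee_{N}\sum_{n=1}^N\mu(\Delta_n)$ in $\overline E$ for pairwise disjoint sequences. It is finite if $\mu(X)\in E$; $\Delta$ has finite measure if $\mu(\Delta)\in E$. It is a Borel measure if compact sets have finite measure; inner regular at $\Delta$ if $\mu(\Delta)=\bigvee\{\mu(K):K\subseteq\Delta\text{ compact}\}$, and outer regular at $\Delta$ if $\mu(\Delta)=\bigwedge\{\mu(V):V\supseteq\Delta\text{ open}\}$, in $\overline E$; a regular Borel measure is a Borel measure that is inner regular at all open sets and outer regular at all Borel sets. Order integral: for $\varphi=\sum_{i=1}^n r_i\chi_{\Delta_i}$ with $r_i\in\mathbb R^+$ and disjoint measurable $\Delta_i$, $\int_X^{o}\varphi\,d\mu=\sum r_i\mu(\Delta_i)\in\overline{E^+}$; for measurable $f\colon X\to[0,\infty]$,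 $\int_X^{o}f\,d\mu=\bigvee_n\int_X^{o}\varphi_n\,d\mu$ for any sequence of such $\varphi_n\uparrow f$ pointwise (independent of the choice). $\mathcal L^1(X,\mathscr B,\mu;\mathbb R^+)$ is the set of measurable $f\colon X\to\mathbb R^+$ with $\int_X^{o}f\,d\mu\in E$; for real-valued $f$ with $\int_X^{o}|f|\,d\mu\in E$, $\int^{o}_X f\,d\mu=\int^{o}_Xf^+\,d\mu-\int^{o}_Xf^-\,d\mu$. $I_\mu(f)=\int_X^{o}f\,d\mu$. $\mathcal B(X,\mathscr B;\mathbb R^+)$ is the set of bounded Borel measurable functions $X\to\mathbb R^+$. $C_c(X)$ is the space of real-valued compactly supported continuous functions. For $S\subseteq X$: $f\prec S$ means $f\in C_c(X)$, $0\le f\le1$, $\operatorname{supp}f\subseteq S$; $S\prec f$ means $f\in C_c(X)$, $0\le f\le 1$, $f=1$ on $S$. For a non-empty subset $S$ of $E$, $S^{\Uparrow}$ (resp. $S^{\uparrow}$) is the set of all $x\in E$ for which there is a net (resp. sequence) in $S$ with $x_\lambda\uparrow x$ in $E$; $S^{\Downarrow}$ and $S^{\downarrow}$ are defined similarly with decreasing nets, resp. sequences; $S^{\Uparrow\Downarrow\uparrow}=((S^{\Uparrow})^{\Downarrow})^{\uparrow}$, etc. *)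

(* Defs.v *)
From HB Require Import structures.
From mathcomp Require Import all_boot all_order all_algebra.
From mathcomp Require Import all_classical all_reals all_analysis.

Set Implicit Arguments.
Unset Strict Implicit.
Unset Printing Implicit Defensive.

Import Order.TTheory GRing.Theory Num.Theory.
Import numFieldNormedType.Exports.

Local Open Scope classical_set_scope.
Local Open Scope ring_scope.

HB.mixin Record Lmodule_isOrdered (R : realType) E
    & Num.POrderedZmodule E & GRing.Lmodule R E := {
  ovs_lerD2r : forall z x y : E, x <= y -> x + z <= y + z ;
  ovs_scaler_ge0 : forall (a : R) (x : E), 0 <= a -> 0 <= x -> 0 <= a *: x
}.

#[short(type="ovsType")]
HB.structure Definition OrderedVectorSpace (R : realType) :=
  { E of Num.POrderedZmodule E & GRing.Lmodule R E & Lmodule_isOrdered R E }.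

Section nets.
Context {d : Order.disp_t} {T : porderType d}.
Implicit Types (S D A : set T) (x : T).

Record directed (I : Type) (leI : I -> I -> Prop) : Prop := Directed {
  directed_inhabited : inhabited I ;
  directed_refl : forall i, leI i i ;
  directed_trans : forall i j k, leI i j -> leI j k -> leI i k ;
  directed_ub : forall i j, exists k, leI i k /\ leI j k
}.

Definition increasing_net (I : Type) (leI : I -> I -> Prop) (u : I -> T) :=
  directed leI /\ forall i j, leI i j -> (u i <= u j)%O.

Definition decreasing_net (I : Type) (leI : I -> I -> Prop) (u : I -> T) :=
  directed leI /\ forall i j, leI i j -> (u j <= u i)%O.

Definition net_up S : set T :=
  [set x | exists (I : Type) (leI : I -> I -> Prop) (u : I -> T),
    [/\ increasing_net leI u, forall i, S (u i) & supremums (range u) x]].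

Definition net_down S : set T :=
  [set x | exists (I : Type) (leI : I -> I -> Prop) (u : I -> T),
    [/\ decreasing_net leI u, forall i, S (u i) & infimums (range u) x]].

Definition seq_up S : set T :=
  [set x | exists u : nat -> T,
    [/\ nondecreasing_seq u, forall n, S (u n) & supremums (range u) x]].

Definition seq_down S : set T :=
  [set x | exists u : nat -> T,
    [/\ nonincreasing_seq u, forall n, S (u n) & infimums (range u) x]].

(* supremum and infimum computed in the subposet D; a lower bound of A in D
   need not dominate all lower bounds of A in T *)
Definition sup_in D A x :=
  [/\ D x, ubound A x & forall y, D y -> ubound A y -> (x <= y)%O].

Definition inf_in D A x :=
  [/\ D x, lbound A x & forall y, D y -> lbound A y -> (y <= x)%O].

Definition monotone_complete :=
  forall (I : Type) (leI : I -> I -> Prop) (u : I -> T),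
    increasing_net leI u -> has_ubound (range u) ->
    exists x, supremums (range u) x.

End nets.
Arguments monotone_complete {d} T.

Definition archimedean_ovs (R : realType) (E : ovsType R) :=
  forall x y : E, (forall n : nat, x *+ n.+1 <= y) -> x <= 0.

Definition pos_cone (R : realType) (E : ovsType R) : set E :=
  [set x | 0 <= x].
Arguments pos_cone {R} E.

Variant ext (E : Type) : Type := Fin of E | Infty.
Arguments Fin {E} _.
Arguments Infty {E}.

Section ext_choice.
Variable E : choiceType.

Definition option_of_ext (x : ext E) : option E :=
  if x is Fin a then Some a else None.
Definition ext_of_option (x : option E) : ext E :=
  if x is Some a then Fin a else Infty.
Lemma option_of_extK : cancel option_of_ext ext_of_option.
Proof. by case. Qed.

HB.instance Definition _ := Choice.copy (ext E) (can_type option_of_extK).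

End ext_choice.

Section ext_ordered.
Context {R : realType} {E : ovsType R}.
Implicit Types x y z : ext E.

Definition le_ext x y : bool :=
  match x, y with
  | Fin a, Fin b => a <= b
  | _, Infty => true
  | Infty, Fin _ => false
  end.

Lemma le_ext_refl : reflexive le_ext.
Proof. by case=> /=. Qed.

Lemma le_ext_anti : antisymmetric le_ext.
Proof. by move=> [a|] [b|] //= /le_anti ->. Qed.

Lemma le_ext_trans : transitive le_ext.
Proof. by move=> [b|] [a|] [c|] //=; exact: le_trans. Qed.

HB.instance Definition _ := Order.Le_isPOrder.Build ring_display (ext E)
  le_ext_refl le_ext_anti le_ext_trans.

Definition add_ext x y : ext E :=
  if x is Fin a then if y is Fin b then Fin (a + b) else Infty else Infty.

Lemma add_extA : associative add_ext.
Proof. by move=> [a|] [b|] [c|] //=; rewrite addrA. Qed.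

Lemma add_extC : commutative add_ext.
Proof. by move=> [a|] [b|] //=; rewrite addrC. Qed.

Lemma add0ext : left_id (Fin 0) add_ext.
Proof. by move=> [a|] //=; rewrite add0r. Qed.

HB.instance Definition _ :=
  GRing.isNmodule.Build (ext E) add_extA add_extC add0ext.

(* only meant for 0 <= r, with the convention 0 * oo = 0 *)
Definition scale_ext (r : R) x : ext E :=
  match x with
  | Fin a => Fin (r *: a)
  | Infty => if r == 0 then Fin 0 else Infty
  end.

Definition is_fin x := exists a, x = Fin a.

End ext_ordered.

(* The library's measurable types are pointed; using the generated
   sigma-algebra directly keeps the empty space. *)
Definition Borel (X : topologicalType) : set (set X) := <<s @open X >>.

Definition Borel_measurable (R : realType) (X : topologicalType)
    (f : X -> R) :=
  forall B : set R, measurable B -> Borel (f @^-1` B).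

Section vector_measures.
Context {R : realType} {X : topologicalType} {E : ovsType R}.
Implicit Types (mu : set X -> ext E) (A K V : set X).

(* mu stands for a map on the Borel sets: its values elsewhere are junk. *)
Record is_measure mu : Prop := IsMeasure {
  measure_pos : forall A, Borel A -> Fin 0 <= mu A ;
  measure_set0 : mu set0 = 0 ;
  measure_sigma_additive : forall F : nat -> set X,
    (forall n, Borel (F n)) -> trivIset setT F ->
    supremums (range (fun N => \sum_(n < N.+1) mu (F n))) (mu (\bigcup_n F n))
}.

Definition inner_regular mu A :=
  supremums [set mu K | K in [set K | compact K /\ K `<=` A]] (mu A).

Definition outer_regular mu A :=
  infimums [set mu V | V in [set V | open V /\ A `<=` V]] (mu A).

Record is_regular_Borel_measure mu : Prop := IsRegularBorelMeasure {
  regular_measure : is_measure mu ;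
  regular_compact : forall K, compact K -> is_fin (mu K) ;
  regular_inner : forall V, open V -> inner_regular mu V ;
  regular_outer : forall A, Borel A -> outer_regular mu A
}.

Definition simple_ointegral mu (phi : X -> R) (x : ext E) :=
  exists (n : nat) (r : 'I_n -> R) (A : 'I_n -> set X),
  [/\ (forall i, 0 <= r i) /\ (forall i, Borel (A i)),
      trivIset setT A,
      phi = (fun t => \sum_(i < n) r i * \1_(A i) t) &
      x = \sum_(i < n) scale_ext (r i) (mu (A i))].

Definition is_ointegral mu (f : X -> \bar R) (x : ext E) :=
  exists (phi : nat -> X -> R) (s : nat -> ext E),
  [/\ forall n, simple_ointegral mu (phi n) (s n),
      forall t, nondecreasing_seq (fun n => phi n t),
      forall t, (phi n t)%:E @[n --> \oo] --> f t &
      supremums (range s) x].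

(* For a measure mu with values in a monotone complete E, the integral exists
   and does not depend on phi as soon as f is measurable and nonnegative;
   otherwise Infty is a dummy value. *)
Definition ointegral mu (f : X -> \bar R) : ext E :=
  xget Infty (is_ointegral mu f).

Definition Iint mu (f : X -> R) : ext E := ointegral mu (EFin \o f).

Definition real_ointegral mu (f : X -> R) (x : E) :=
  is_fin (Iint mu (fun t => `|f t|)) /\
  exists a b, [/\ Iint mu f^\+ = Fin a, Iint mu f^\- = Fin b & x = a - b].

Definition L1pos mu : set (X -> R) :=
  [set f | [/\ Borel_measurable f, forall t, 0 <= f t & is_fin (Iint mu f)]].

End vector_measures.

Definition Bpos (R : realType) (X : topologicalType) : set (X -> R) :=
  [set f | [/\ Borel_measurable f, forall t, 0 <= f t &
               exists M, forall t, f t <= M]].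
Arguments Bpos : clear implicits.

Section Cc.
Variables (X : topologicalType) (R : realType).

Definition supp (f : X -> R) : set X := closure [set t | f t != 0].

Definition Cc_pred : {pred X -> R} :=
  fun f => `[< continuous f /\ compact (supp f) >].

Lemma Cc_submod_closed : submod_closed Cc_pred.
Proof.
have cptS (f : X -> R) A : compact A -> supp f `<=` A -> compact (supp f).
  by move=> cA fA; apply: (subclosed_compact _ cA) => //; exact: closed_closure.
split.
  apply/asboolP; split; first exact: cst_continuous.
  rewrite /supp (_ : [set _ | _] = set0) ?closure0; first exact: compact0.
  by apply/seteqP; split=> // t /=; rewrite eqxx.
move=> a f g /asboolP[cf kf] /asboolP[cg kg]; apply/asboolP; split.
  move=> t; apply: cvgD; last exact: cg.
  by apply: cvgM; [exact: cvg_cst|exact: cf].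
apply: (cptS _ (supp f `|` supp g)); first exact: compactU.
rewrite -closureU; apply: closureS => t; rewrite /setU/= -[X in X != _]/(a *: f t + g t).
have [->|? _] := eqVneq (f t) 0; last by left.
by rewrite scaler0 add0r; right.
Qed.

HB.instance Definition _ :=
  GRing.isSubmodClosed.Build R (X -> R) Cc_pred Cc_submod_closed.

Record Cc := MkCc { Cc_fun :> X -> R ; Cc_funP : Cc_fun \in Cc_pred }.

HB.instance Definition _ := [isSub for Cc_fun].
HB.instance Definition _ := [Choice of Cc by <:].
HB.instance Definition _ := [SubChoice_isSubLmodule of Cc by <:].

(* the f with f ≺ S *)
Definition below_set (S : set X) : set Cc :=
  [set f : Cc | (forall t, 0 <= f t <= 1) /\ supp f `<=` S].

(* the f with S ≺ f *)
Definition above_set (S : set X) : set Cc :=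
  [set f : Cc | (forall t, 0 <= f t <= 1) /\ (forall t, S t -> f t = 1)].

Definition Cc_pos : set Cc := [set f : Cc | forall t, 0 <= f t].

End Cc.
Arguments below_set {X} R S.
Arguments above_set {X} R S.
Arguments Cc_pos : clear implicits.

(* Main.v *)
(* S^up^down and S^down^up are convex cones, and every integral in the statement
   is a monotone limit of integrals of step functions, so it suffices to place
   the measures of single sets.  The measure of an open set is the supremum of
   the directed set of [pi f] with f below it, hence outer regularity puts
   measures of Borel sets in S^up^down; dually, through compact sets, inner
   regularity puts them in S^down^up.  For bounded f and finite mu, the dyadic
   truncations of f raised by 2^-n decrease to f uniformly, and their integrals
   decrease to that of f because E is Archimedean. *)
Require Import Defs.
From HB Require Import structures.
From mathcomp Require Import all_boot all_order all_algebra.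
From mathcomp Require Import all_classical all_reals all_analysis.
From mathcomp Require Import lra.

Import Order.TTheory GRing.Theory Num.Theory.
Import numFieldNormedType.Exports.

Local Open Scope classical_set_scope.
Local Open Scope ring_scope.

Set Implicit Arguments.
Unset Strict Implicit.

(** * Ordered vector spaces: suprema and infima of directed sets *)

Section ordered_vector_space.
Context {R : realType} {E : ovsType R}.
Implicit Types (x y z w : E) (a b : R) (S A D : set E).

Lemma ov_lerD x y z w : x <= y -> z <= w -> x + z <= y + w.
Proof.
move=> xy zw; apply: (le_trans (ovs_lerD2r z _ _ xy)).
by rewrite ![y + _]addrC; exact: ovs_lerD2r.
Qed.

Lemma ov_subr_ge0 x y : (0 <= y - x) = (x <= y).
Proof.
apply/idP/idP => [/(ovs_lerD2r x)|/(ovs_lerD2r (- x))].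
  by rewrite add0r subrK.
by rewrite subrr.
Qed.

Lemma ov_lerBlDr x y z : (x - y <= z) = (x <= z + y).
Proof.
by rewrite -[LHS]ov_subr_ge0 -[RHS]ov_subr_ge0 opprB addrA.
Qed.

Lemma ov_lerBrDr x y z : (x <= y - z) = (x + z <= y).
Proof. by rewrite -{2}[z]opprK ov_lerBlDr. Qed.

Lemma ov_lerN2 x y : (- x <= - y) = (y <= x).
Proof. by rewrite -[LHS]ov_subr_ge0 opprK addrC ov_subr_ge0. Qed.

Lemma ov_addr_ge0 x y : 0 <= x -> 0 <= y -> 0 <= x + y.
Proof. by move=> x0 y0; rewrite -[0]addr0; exact: ov_lerD. Qed.

Lemma ov_ler_wpZ2l a x y : 0 <= a -> x <= y -> a *: x <= a *: y.
Proof.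
move=> a0 xy; rewrite -ov_subr_ge0 -scalerBr.
by apply: ovs_scaler_ge0 => //; rewrite ov_subr_ge0.
Qed.

Lemma ov_ler_wpZ2r a b x : 0 <= x -> a <= b -> a *: x <= b *: x.
Proof.
move=> x0; rewrite -ov_subr_ge0 -scalerBl -subr_ge0 => ab.
exact: ovs_scaler_ge0.
Qed.

Definition convex_cone S := [/\ S 0, forall x y, S x -> S y -> S (x + y) &
  forall a x, 0 <= a -> S x -> S (a *: x)].

Definition up_directed D := D !=set0 /\
  forall x y, D x -> D y -> exists z, [/\ D z, x <= z & y <= z].

(** The range of an increasing net is directed, and a directed set is a net indexed by itself.
    Limits of nets become suprema of directed sets, free of index types. *)
Lemma net_upP S x : net_up S x <->
  exists D, [/\ up_directed D, D `<=` S & supremums D x].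
Proof.
split=> [[I [le [u [[[[i0] _ _ ub] mono] Su supu]]]]|].
  exists (range u); split=> //; last by move=> _ [i _ <-].
  split; first by exists (u i0), i0.
  move=> _ _ [i _ <-] [j _ <-]; have [k [ik jk]] := ub i j.
  by exists (u k); split; [exists k|exact: mono..].
move=> [D [[[d0 Dd0] dirD] DS supD]].
exists {d : E | D d}, (fun d e => sval d <= sval e), sval.
have rangeD : range (@sval E D) = D.
  by apply/seteqP; split=> [_ [[d Dd] _ <-] //|d Dd]; exists (exist _ d Dd).
split; last by rewrite rangeD.
  split=> //; split.
  - by constructor; exists d0.
  - by move=> ?.
  - by move=> ? ? ?; exact: le_trans.
  - move=> [d Dd] [e De]; have [z [Dz dz ez]] := dirD _ _ Dd De.
    by exists (exist _ z Dz).
by move=> [d Dd]; exact: DS.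
Qed.

(** Suprema add up: if [z] bounds all sums [d + f], then [z - f] bounds [D] for each [f], and so on
    for [F]. Scaling by [a > 0] is an order automorphism; [a = 0] is treated apart. *)
Lemma net_up_cone S : convex_cone S -> convex_cone (net_up S).
Proof.
move=> [S0 SD SZ].
have S0' : net_up S 0.
  apply/net_upP; exists [set 0]; split; last by rewrite supremums1.
    by split=> [|_ _ -> ->]; exists 0.
  by move=> _ ->.
split=> // [x y|a x].
  move=> /net_upP[D [[[d0 Dd0] dirD] DS [ubD lubD]]].
  move=> /net_upP[F [[[f0 Ff0] dirF] FS [ubF lubF]]].
  apply/net_upP; exists [set d + f | d in D & f in F].
  split; [split| |split].
  - by exists (d0 + f0), d0 => //; exists f0.
  - move=> _ _ [d Dd [f Ff <-]] [d' Dd' [f' Ff' <-]].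
    have [d2 [Dd2 dd2 dd2']] := dirD _ _ Dd Dd'.
    have [f2 [Ff2 ff2 ff2']] := dirF _ _ Ff Ff'.
    exists (d2 + f2); split; [|exact: ov_lerD..].
    by exists d2 => //; exists f2.
  - by move=> _ [d Dd [f Ff <-]]; apply: SD; [exact: DS|exact: FS].
  - by move=> _ [d Dd [f Ff <-]]; apply: ov_lerD; [exact: ubD|exact: ubF].
  - move=> z ubz; rewrite addrC -ov_lerBrDr; apply: lubF => f Ff.
    rewrite ov_lerBrDr addrC -ov_lerBrDr; apply: lubD => d Dd.
    by rewrite ov_lerBrDr; apply: ubz; exists d => //; exists f.
rewrite le_eqVlt => /predU1P[<- _|a0]; first by rewrite scale0r.
move=> /net_upP[D [[[d0 Dd0] dirD] DS [ubD lubD]]].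
apply/net_upP; exists [set a *: d | d in D]; split; [split| |split].
- by exists (a *: d0), d0.
- move=> _ _ [d Dd <-] [e De <-]; have [z [Dz dz ez]] := dirD _ _ Dd De.
  by exists (a *: z); split; [exists z|exact: ov_ler_wpZ2l (ltW a0) _..].
- by move=> _ [d Dd <-]; apply: SZ; [exact: ltW|exact: DS].
- by move=> _ [d Dd <-]; apply: ov_ler_wpZ2l; [exact: ltW|exact: ubD].
- move=> z ubz; rewrite -[z](scalerKV (lt0r_neq0 a0)).
  apply: ov_ler_wpZ2l; first exact: ltW.
  apply: lubD => d Dd; rewrite -[d](scalerK (lt0r_neq0 a0)).
  by apply: ov_ler_wpZ2l; [rewrite invr_ge0 ltW|apply: ubz; exists d].
Qed.

Definition opp_set S := [set x | S (- x)].

Lemma opp_set_cone S : convex_cone S -> convex_cone (opp_set S).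
Proof.
move=> [S0 SD SZ]; rewrite /opp_set; split=> /= [|x y Sx Sy|a x a0 Sx].
- by rewrite oppr0.
- by rewrite opprD; exact: SD.
- by rewrite -scalerN; exact: SZ.
Qed.

Lemma infimums_opp D x : infimums D x <-> supremums (opp_set D) (- x).
Proof.
split=> -[bnd best]; split.
- by move=> y /bnd; rewrite -ov_lerN2 opprK.
- move=> y uby; rewrite -[y]opprK ov_lerN2; apply: best => z Dz.
  by rewrite -ov_lerN2 opprK; apply: uby; rewrite /opp_set /= opprK.
- by move=> y Dy; rewrite -ov_lerN2; apply: bnd; rewrite /opp_set /= opprK.
- move=> y lby; rewrite -ov_lerN2; apply: best => z Dz.
  by rewrite -ov_lerN2 opprK; exact: lby.
Qed.

(** Negation reverses the order, which carries the results on increasing nets over to decreasing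
    ones. *)
Lemma net_down_opp S x : net_down S x <-> net_up (opp_set S) (- x).
Proof.
have rangeN (I : Type) (u : I -> E) :
    opp_set (range u) = range (fun i => - u i).
  apply/seteqP; split=> [y [i _ yE]|_ [i _ <-]]; exists i => //.
    by rewrite yE opprK.
  by rewrite opprK.
split=> -[I [le [u [[dir mono] Su ext]]]];
  exists I, le, (fun i => - u i); split.
- by split=> // i j ij; rewrite ov_lerN2; exact: mono.
- by move=> i; rewrite /opp_set /= opprK.
- by rewrite -rangeN; apply/infimums_opp.
- by split=> // i j ij; rewrite ov_lerN2; exact: mono.
- by move=> i; exact: Su.
- by apply/infimums_opp; rewrite rangeN; under eq_fun do rewrite opprK.
Qed.

Lemma net_down_cone S : convex_cone S -> convex_cone (net_down S).
Proof.
move=> /opp_set_cone/net_up_cone/opp_set_cone.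
rewrite (_ : opp_set _ = net_down S) //.
by apply/seteqP; split=> x /net_down_opp.
Qed.

Definition down_directed D := D !=set0 /\
  forall x y, D x -> D y -> exists z, [/\ D z, z <= x & z <= y].

Lemma opp_set_directed D : down_directed D -> up_directed (opp_set D).
Proof.
move=> [[d Dd] dir]; split; first by exists (- d); rewrite /opp_set /= opprK.
move=> x y Dx Dy; have [z [Dz zx zy]] := dir _ _ Dx Dy.
exists (- z).
by rewrite /opp_set /= opprK -ov_lerN2 opprK -(ov_lerN2 (- z)) opprK.
Qed.

Lemma net_downW D S x : down_directed D -> D `<=` S -> infimums D x ->
  net_down S x.
Proof.
move=> dirD DS infD; apply/net_down_opp/net_upP; exists (opp_set D); split.
- exact: opp_set_directed.
- by move=> y; exact: DS.
- exact/infimums_opp.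
Qed.

Lemma monotone_complete_sup D : monotone_complete E -> up_directed D ->
  ubound D !=set0 -> exists x, supremums D x.
Proof.
move=> mcE dirD [b ubD].
pose I := {e : E | D e}; pose le (d e : I) := sval d <= sval e.
have rangeD : range (@sval E D) = D.
  by apply/seteqP; split=> [_ [[d Dd] _ <-] //|d Dd]; exists (exist _ d Dd).
have [||x] := mcE I le sval; last by rewrite rangeD => ?; exists x.
- case: dirD => -[d0 Dd0] dirD; split=> //; split.
  + by constructor; exists d0.
  + by move=> ?; rewrite /le.
  + by move=> ? ? ?; exact: le_trans.
  + move=> [d Dd] [e De]; have [z [Dz dz ez]] := dirD _ _ Dd De.
    by exists (exist _ z Dz).
- by exists b; rewrite rangeD.
Qed.

(* In contrast to the supremum, the infimum in the positive cone need not be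
   an infimum in [E]; completeness is what makes them agree. *)
Lemma inf_in_pos_cone D x : monotone_complete E -> down_directed D ->
  inf_in (pos_cone E) D x -> infimums D x.
Proof.
move=> mcE dirD [x0 lbx glbx].
have [|y infy] := monotone_complete_sup mcE (opp_set_directed dirD).
  by exists (- x) => z /lbx; rewrite -ov_lerN2 opprK.
have {infy}[lby glby] : infimums D (- y) by apply/infimums_opp; rewrite opprK.
have xy : x <= - y by exact: glby.
have yx : - y <= x by apply: glbx => //; exact: le_trans xy.
by rewrite (le_anti (introT andP (conj xy yx))); split.
Qed.

End ordered_vector_space.

(** * Compactly supported continuous functions *)

Section compactly_supported.
Context {R : realType} {X : topologicalType}.
Implicit Types (f g : Cc X R) (A K U : set X).

Lemma Cc_continuous f : continuous f.
Proof. by have /asboolP[] := Cc_funP f. Qed.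

Lemma Cc_supp_compact f : compact (supp f).
Proof. by have /asboolP[] := Cc_funP f. Qed.

Arguments Cc_continuous : clear implicits.
Arguments Cc_supp_compact : clear implicits.

Lemma CcD f g t : (f + g) t = f t + g t. Proof. by []. Qed.
Lemma CcB f g t : (f - g) t = f t - g t. Proof. by []. Qed.
Lemma CcZ (a : R) f t : (a *: f) t = a * f t. Proof. by []. Qed.

(** Closedness of [K] keeps the closure of the non-zero set inside [K], where it is compact as a
    closed subset. *)
Lemma Cc_mk (h : X -> R) K : continuous h -> compact K -> closed K ->
  (forall t, h t != 0 -> K t) ->
  exists f : Cc X R, Cc_fun f = h /\ supp f `<=` K.
Proof.
move=> ch cK clK hK.
have sK : supp h `<=` K by move/closure_id : clK => ->; exact: closureS.
have hCc : h \in Cc_pred (R:=R).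
  apply/asboolP; split=> //.
  by apply: (subclosed_compact _ cK) => //; exact: closed_closure.
by exists (MkCc hCc).
Qed.

Lemma Cc_max f g : exists h : Cc X R,
  (forall t, h t = Num.max (f t) (g t)) /\ supp h `<=` supp f `|` supp g.
Proof.
have [|||t|h [hE hs]] := @Cc_mk (f \max g) (supp f `|` supp g).
- by move=> t; apply: continuous_max; exact: Cc_continuous.
- by apply: compactU; exact: Cc_supp_compact.
- exact: (closedU (@closed_closure _ _) (@closed_closure _ _)).
- rewrite /= maxEle; case: ifP => _ ?; [right|left]; exact: subset_closure.
- by exists h; split=> // t; rewrite hE.
Qed.

Lemma Cc_min f g : exists h : Cc X R, forall t, h t = Num.min (f t) (g t).
Proof.
have [h [hE _]] := Cc_max (- f) (- g); exists (- h) => t.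
rewrite -[(- h) t]/(- h t) hE -[(- f) t]/(- f t) -[(- g) t]/(- g t).
by rewrite oppr_max !opprK.
Qed.

Lemma below_set0 U : below_set R U 0.
Proof.
split=> [t|]; first by rewrite lexx ler01.
rewrite /supp (_ : [set _ | _] = set0) ?closure0 //.
by apply/seteqP; split=> // t /=; rewrite eqxx.
Qed.

Hypotheses (hausX : hausdorff_space X) (lcX : locally_compact [set: X]).

(** Complete regularity separates [x] from the complement of the interior of a compact
    neighbourhood; one minus the separating function vanishes off that neighbourhood. *)
Lemma exists_Cc_point (x : X) :
  exists f : Cc X R, (forall t, 0 <= f t <= 1) /\ f x = 1.
Proof.
have [U] := @lcX x I; rewrite withinET => Ux [cU clU].
have clI : closed (~` U°) by rewrite closedC; exact: open_interior.
have nIx : ~ (~` U°) x by move=> /=; apply.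
have /(@uniform_separatorP _ R)[h [ch h01 h0 h1]] :=
  @locally_compact_completely_regular X R lcX hausX x _ clI nIx.
have [|t|f [fE _]] := @Cc_mk (fun t => 1 - h t) U _ cU clU.
- by move=> t; apply: cvgB; [exact: cvg_cst|exact: ch].
- rewrite subr_eq0 => ht; apply: contrapT => nUt; move: ht.
  suff -> : h t = 1 by rewrite eqxx.
  by apply: h1; exists t => // /interior_subset.
exists f; rewrite fE; split=> [t|].
  have /h01 : range h (h t) by exists t.
  by rewrite /= in_itv /= subr_ge0 gerBl => /andP[-> ->].
by suff -> : h x = 0 by [rewrite subr0]; apply: h0; exists x.
Qed.

(** By compactness some [g] in [Cc_pos] is at least 1 on [K]; its minimum with 1 is the required
    function. *)
Lemma above_set_nonempty K : compact K -> above_set R K !=set0.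
Proof.
move=> cK.
have [f fP] := choice exists_Cc_point.
have fge0 x t : 0 <= f x t by have [/(_ t)/andP[]] := fP x.
(* The filter of eventually large functions: [g + h] dominates both [g] and [h]. It lets the
   covering form of compactness replace a finite subcover and a finite sum. *)
pose F := filter_from (Cc_pos X R)
  (fun g => [set h : Cc X R | forall t, g t <= h t]).
have FF : Filter F.
  apply: filter_from_filter; first by exists 0 => t.
  move=> g h g0 h0; exists (g + h); first by move=> t; rewrite CcD addr_ge0.
  move=> u ghu; split=> t; apply: le_trans (ghu t); rewrite CcD.
    by rewrite lerDl.
  by rewrite lerDr.
have [g g0 /(_ g (fun=> lexx _)) gK] :
    \forall g \near F, K `<=` [set t | 1 <= (g : Cc X R) t].
  have /compact_near_coveringP := cK; apply => x Kx.
  (* Near [x] the function [f x] exceeds one half, so its double exceeds 1 there. *)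
  exists ([set t | 2^-1 < f x t],
          [set h : Cc X R | forall t, (2 *: f x : Cc X R) t <= h t]).
    split; last by exists (2 *: f x) => [t|h]; [by rewrite CcZ mulr_ge0|].
    apply: (open_nbhs_nbhs); split=> /=.
      by move/continuousP: (Cc_continuous (f x)) => /(_ _ (@open_gt _ 2^-1)).
    by have [_ ->] := fP x; rewrite invf_lt1 ?ltr1n.
  move=> [t h] [/= ft fh]; have {fh} : 2 * f x t <= h t by exact: fh.
  apply: le_trans.
  by rewrite -(@ler_pM2l _ 2^-1) // mulKf // mulr1 ltW.
have [h hE] : exists h : Cc X R, forall t, h t = Num.min (g t) 1.
  have [|||t|h [hE _]] := @Cc_mk (fun t => Num.min (g t) 1) (supp g).
  - move=> t; apply: continuous_min; [exact: Cc_continuous|exact: cvg_cst].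
  - exact: Cc_supp_compact.
  - exact: closed_closure.
  - move=> gt1; apply: subset_closure => /=; apply: contra_neq gt1 => ->.
    by rewrite min_l.
  - by exists h => t; rewrite hE.
exists h; split=> t; rewrite hE.
  by rewrite le_min ler01 ge_min lexx orbT !andbT.
by move=> Kt; rewrite min_r // gK.
Qed.

End compactly_supported.

(** * Values of a positive operator on functions below or above a set *)

Section positive_operator.
Context {R : realType} {X : topologicalType} {E : ovsType R}.
Variable pi : {linear Cc X R -> E}.
Hypothesis pi_ge0 : forall f : Cc X R, (forall t, 0 <= f t) -> 0 <= pi f.
Let S := pi @` Cc_pos X R.

Lemma positive_operator_le (f g : Cc X R) :
  (forall t, f t <= g t) -> pi f <= pi g.
Proof.
move=> fg; rewrite -ov_subr_ge0 -linearB; apply: pi_ge0 => t.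
by rewrite CcB subr_ge0.
Qed.

Lemma positive_operator_cone : convex_cone S.
Proof.
split=> [|_ _ [f f0 <-] [g g0 <-]|a _ a0 [f f0 <-]].
- by exists 0; [move=> t|rewrite linear0].
- by exists (f + g); [move=> t; rewrite CcD; apply: addr_ge0|rewrite linearD].
- by exists (a *: f); [move=> t; rewrite CcZ; apply: mulr_ge0|rewrite linearZ].
Qed.

(** The pointwise maximum of two functions below [V] is again below [V], which makes their images
    directed. *)
Lemma below_set_net_up (V : set X) v :
  sup_in (pos_cone E) (pi @` below_set R V) v -> net_up S v.
Proof.
move=> [v0 ubv lubv]; apply/net_upP; exists (pi @` below_set R V); split.
- split.
    by exists (pi 0), 0 => //; exact: below_set0.
  move=> _ _ [f [f01 fV] <-] [g [g01 gV] <-]; have [h [hE hs]] := Cc_max f g.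
  exists (pi h); split; [|apply: positive_operator_le => t..].
  + exists h => //; split=> [t|t /hs[/fV|/gV]] //.
    rewrite hE le_max ge_max; have /andP[-> ->] := f01 t.
    by have /andP[_ ->] := g01 t.
  + by rewrite hE le_max lexx.
  + by rewrite hE le_max lexx orbT.
- by move=> _ [f [f01 _] <-]; exists f => // t; have /andP[] := f01 t.
(* A supremum in the cone competes only with positive upper bounds; every upper bound is positive,
   as the zero function is below [V]. *)
- split=> // y uby; apply: lubv => //.
  by apply: uby; exists 0; [exact: below_set0|rewrite linear0].
Qed.

(** Pointwise minima make the images directed downwards, once there is at least one;
    [inf_in_pos_cone] then moves the infimum from the cone to [E]. *)
Lemma above_set_net_down (K : set X) k : monotone_complete E ->
  above_set R K !=set0 ->
  inf_in (pos_cone E) (pi @` above_set R K) k -> net_down S k.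
Proof.
move=> mcE [f0 Kf0] infk.
have dirK : down_directed (pi @` above_set R K).
  split; first by exists (pi f0), f0.
  move=> _ _ [f [f01 fK] <-] [g [g01 gK] <-]; have [h hE] := Cc_min f g.
  exists (pi h); split; [|apply: positive_operator_le => t..].
  + exists h => //; split=> [t|t Kt]; last by rewrite hE fK // gK // minxx.
    rewrite hE le_min ge_min; have /andP[-> ->] := f01 t.
    by have /andP[-> _] := g01 t.
  + by rewrite hE ge_min lexx.
  + by rewrite hE ge_min lexx orbT.
apply: (net_downW dirK); last exact: inf_in_pos_cone.
by move=> _ [f [f01 _] <-]; exists f => // t; have /andP[] := f01 t.
Qed.

End positive_operator.

(* [Borel] unfolds to a product, which automatic implicit arguments would
   expose. *)
Unset Implicit Arguments.

(** * Closure properties of the Borel sets *)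

Section borel.
Context {X : topologicalType}.
Implicit Types A B : set X.

Lemma open_Borel {A} : open A -> Borel A.
Proof. exact: sub_sigma_algebra. Qed.

Lemma Borel0 : Borel (@set0 X).
Proof. exact: sigma_algebra0. Qed.

Lemma BorelC {A} : Borel A -> Borel (~` A).
Proof.
by move=> bA; rewrite -setTD; exact (@sigma_algebraCD _ setT open A bA).
Qed.

Lemma BorelT : Borel [set: X].
Proof. by rewrite -setC0; exact (BorelC Borel0). Qed.

Lemma Borel_bigcup {F : nat -> set X} :
  (forall n, Borel (F n)) -> Borel (\bigcup_n F n).
Proof. exact: sigma_algebra_bigcup. Qed.

Lemma BorelU {A B} : Borel A -> Borel B -> Borel (A `|` B).
Proof.
move=> bA bB; rewrite -bigcup2E; apply Borel_bigcup => -[|[|n]] //=.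
exact Borel0.
Qed.

Lemma BorelI {A B} : Borel A -> Borel B -> Borel (A `&` B).
Proof.
move=> bA bB; rewrite -[_ `&` _]setCK setCI.
exact (BorelC (BorelU (BorelC bA) (BorelC bB))).
Qed.

Lemma BorelD {A B} : Borel A -> Borel B -> Borel (A `\` B).
Proof. by move=> bA bB; rewrite setDE; exact (BorelI bA (BorelC bB)). Qed.

End borel.

Set Implicit Arguments.

(** * Order and addition on the extended space *)

Section extended.
Context {R : realType} {E : ovsType R}.
Implicit Types (x y z : ext E) (D : set E).

Lemma InftyD x : Infty + x = Infty. Proof. by case: x. Qed.

Lemma le_Infty x : (x <= Infty)%O. Proof. by case: x. Qed.

Lemma le_extD x y z : (x <= y)%O -> (x + z <= y + z)%O.
Proof. by case: x y z => [a|] [b|] [c|] //= ab; exact: ovs_lerD2r. Qed.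

Lemma supremums_Fin D a : D !=set0 ->
  supremums D a <-> supremums (Fin @` D) (Fin a).
Proof.
move=> [d0 Dd0]; split=> -[ub lub]; split.
- by move=> _ [d Dd <-]; exact: ub.
- move=> [b|_]; last exact: le_Infty.
  by move=> ubb; apply: lub => d Dd; apply: (ubb (Fin d)); exists d.
- by move=> d Dd; apply: (ub (Fin d)); exists d.
- by move=> b ubb; apply: (lub (Fin b)) => _ [d Dd <-]; exact: ubb.
Qed.

End extended.

(** * Finite additivity and integrals of step functions *)

Section measure.
Context {R : realType} {X : topologicalType} {E : ovsType R}.
Variable mu : set X -> ext E.
Hypothesis mu_measure : is_measure mu.
Implicit Types (A B : set X) (s : seq (R * set X)).

(** The value at [Infty] is a dummy; 0 keeps the result positive for every Borel set. *)
Definition fin_part (x : ext E) : E := if x is Fin a then a else 0.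

Let m A := fin_part (mu A).

Lemma fin_partK (x : ext E) : is_fin x -> Fin (fin_part x) = x.
Proof. by case=> a ->. Qed.

Lemma measure_setU A B : Borel A -> Borel B -> A `&` B = set0 ->
  mu (A `|` B) = mu A + mu B.
Proof.
move=> bA bB AB0.
have bF n : Borel (bigcup2 A B n) by case: n => [|[|n]] //=; exact Borel0.
have := Defs.measure_sigma_additive mu_measure bF.
rewrite -trivIset_bigcup2 bigcup2E => /(_ AB0) sup.
apply: (is_subset1_supremums sup).
(* The sequence is [A], [B], then empty sets, so the partial sums are constant from the second on.
   The first one is [mu A], which is no larger because [mu B] is positive. *)
have sumE N : \sum_(n < N.+2) mu (bigcup2 A B n) = mu A + mu B.
  rewrite big_ord_recl big_ord_recl /= big1 ?addr0 // => i _.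
  exact: (measure_set0 mu_measure).
split.
  move=> _ [[|N] _ <-]; last by rewrite sumE.
  rewrite big_ord_recl big_ord0 /= addr0 -[leLHS]add0r [leRHS]addrC.
  by apply: le_extD; apply: (measure_pos mu_measure).
by move=> y uby; apply: uby; exists 1%N => //; rewrite sumE.
Qed.

Lemma measure_le A B : Borel A -> Borel B -> A `<=` B -> (mu A <= mu B)%O.
Proof.
move=> bA bB AB; rewrite -(setDUK AB) measure_setU //; last 2 first.
- exact (BorelD bB bA).
- by rewrite setDIK.
rewrite addrC -[leLHS]add0r; apply: le_extD.
by apply: (measure_pos mu_measure); exact (BorelD bB bA).
Qed.

Lemma is_fin_le (x y : ext E) : (x <= y)%O -> is_fin y -> is_fin x.
Proof. by move=> + [b yE]; rewrite yE; case: x => [a|] // _; exists a. Qed.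

Lemma measure_fin_sub A B : Borel A -> Borel B -> A `<=` B ->
  is_fin (mu B) -> is_fin (mu A).
Proof. by move=> bA bB AB; apply: is_fin_le; exact: measure_le. Qed.

Lemma measure_fin_setU A B : Borel A -> Borel B ->
  is_fin (mu A) -> is_fin (mu B) -> is_fin (mu (A `|` B)).
Proof.
move=> bA bB fA fB; have bBA := BorelD bB bA.
have -> : A `|` B = A `|` (B `\` A) by rewrite setUDr setDv setD0.
rewrite measure_setU ?setDIK //.
have [a ->] := fA.
have [b ->] : is_fin (mu (B `\` A)).
  by apply: measure_fin_sub fB => //; exact: subDsetl.
by exists (a + b).
Qed.

Lemma fin_part_ge0 A : Borel A -> 0 <= m A.
Proof.
move=> bA; have := measure_pos mu_measure bA.
by rewrite /m; case: (mu A) => /=.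
Qed.

Lemma fin_part_setU A B : Borel A -> Borel B ->
  is_fin (mu A) -> is_fin (mu B) -> A `&` B = set0 -> m (A `|` B) = m A + m B.
Proof.
by move=> bA bB [a aE] [b bE] AB0; rewrite /m measure_setU // aE bE.
Qed.

Lemma fin_part_split A B : Borel A -> Borel B -> is_fin (mu A) ->
  m A = m (A `&` B) + m (A `\` B).
Proof.
move=> bA bB fA; have bI := BorelI bA bB; have bD := BorelD bA bB.
rewrite -[in LHS](setUIDK A B) fin_part_setU //.
- by apply: measure_fin_sub fA => //; exact: subIsetl.
- by apply: measure_fin_sub fA => //; exact: subDsetl.
- by rewrite setDE setIACA setICr setI0.
Qed.

Lemma fin_part_set0 : m set0 = 0.
Proof. by rewrite /m (measure_set0 mu_measure). Qed.

(** Coefficients may be negative and sets may overlap: sums are then concatenations, and differences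
    stay in the same format. *)
Definition step_fun s (t : X) : R := \sum_(p <- s) p.1 * \1_(p.2) t.

Definition step_int s : E := \sum_(p <- s) p.1 *: m p.2.

Definition fin_step s := forall p, p \in s -> Borel p.2 /\ is_fin (mu p.2).

(* Cutting the domain [D] along the sets of the list one at a time replaces
   the passage to the atoms of the algebra they generate. *)
Lemma step_int_ge0_in s c D : Borel D -> is_fin (mu D) ->
  (forall p, p \in s -> Borel p.2) ->
  (forall t, D t -> 0 <= c + step_fun s t) ->
  0 <= c *: m D + \sum_(p <- s) p.1 *: m (D `&` p.2).
Proof.
elim: s c D => [|p s IHs] c D bD fD bs s_ge0.
  (* On an empty [D] the sign of [c] is unknown, but then the measure is 0. *)
  rewrite big_nil addr0; have [->|/set0P[t Dt]] := eqVneq D set0.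
    by rewrite fin_part_set0 scaler0.
  have := s_ge0 t Dt; rewrite /step_fun big_nil addr0 => c0.
  by apply: ovs_scaler_ge0 => //; exact: fin_part_ge0.
have bp : Borel p.2 by apply: bs; rewrite mem_head.
have {}bs q : q \in s -> Borel q.2 by move=> qs; apply: bs; rewrite inE qs orbT.
have bI := BorelI bD bp; have bM := BorelD bD bp.
have fI : is_fin (mu (D `&` p.2)).
  by apply: measure_fin_sub fD => //; exact: subIsetl.
have fM : is_fin (mu (D `\` p.2)).
  by apply: measure_fin_sub fD => //; exact: subDsetl.
(* Inside [p.2] the constant absorbs the coefficient [p.1]; outside it, the constant is
   unchanged. *)
have geI : 0 <= (c + p.1) *: m (D `&` p.2) +
    \sum_(q <- s) q.1 *: m (D `&` p.2 `&` q.2).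
  apply: IHs => // t [Dt pt]; have := s_ge0 t Dt.
  by rewrite /step_fun big_cons indicE mem_set // mulr1 addrA.
have geM : 0 <= c *: m (D `\` p.2) +
    \sum_(q <- s) q.1 *: m ((D `\` p.2) `&` q.2).
  apply: IHs => // t [Dt pt]; have := s_ge0 t Dt.
  by rewrite /step_fun big_cons indicE memNset // mulr0 add0r.
apply: le_trans (ov_addr_ge0 geI geM) _.
rewrite le_eqVlt; apply/orP; left; apply/eqP.
rewrite addrACA -big_split /= big_cons (fin_part_split bD bp fD) addrA.
rewrite scalerDr scalerDl [c *: _ + p.1 *: _ + _]addrAC.
congr (_ + _); rewrite !big_seq; apply: eq_bigr => q qs.
have bq := bs _ qs; have bDq := BorelI bD bq.
rewrite (fin_part_split bDq bp); last first.
  by apply: measure_fin_sub fD => //; exact: subIsetl.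
by rewrite scalerDr !setDE ![D `&` _ `&` q.2]setIAC.
Qed.

Lemma fin_step_cat s1 s2 : fin_step s1 -> fin_step s2 -> fin_step (s1 ++ s2).
Proof. by move=> f1 f2 p; rewrite mem_cat => /orP[/f1|/f2]. Qed.

Lemma step_fun_cat s1 s2 t :
  step_fun (s1 ++ s2) t = step_fun s1 t + step_fun s2 t.
Proof. exact: big_cat. Qed.

Lemma step_int_cat s1 s2 : step_int (s1 ++ s2) = step_int s1 + step_int s2.
Proof. exact: big_cat. Qed.

(** Supplies the domain for [step_int_ge0_in], since the whole space may have infinite measure. *)
Lemma fin_step_cover s : fin_step s -> exists D, [/\ Borel D, is_fin (mu D) &
  forall p, p \in s -> p.2 `<=` D].
Proof.
elim: s => [_|p s IHs fs].
  exists set0; split; [exact Borel0| |by []].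
  by exists 0; exact: (measure_set0 mu_measure).
have [bp fp] := fs p (mem_head _ _).
have [|D [bD fD sD]] := IHs.
  by move=> q qs; apply: fs; rewrite inE qs orbT.
exists (p.2 `|` D); split; [exact (BorelU bp bD)|exact: measure_fin_setU|].
by move=> q; rewrite inE => /orP[/eqP->|/sD qD] t; [left|right; exact: qD].
Qed.

(** The difference of the two lists is a positive step function on a common cover, so its integral
    is positive. In particular [step_int] depends only on the function, not on the list. *)
Lemma step_int_le s1 s2 : fin_step s1 -> fin_step s2 ->
  (forall t, step_fun s1 t <= step_fun s2 t) -> step_int s1 <= step_int s2.
Proof.
move=> f1 f2 s12; pose s1N := [seq (- p.1, p.2) | p <- s1].
have s1NE t : step_fun s1N t = - step_fun s1 t.
  by rewrite /step_fun big_map -sumrN; apply: eq_bigr => p _; rewrite mulNr.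
have f1N : fin_step s1N by move=> p /mapP[q /f1 ? ->].
have fs := fin_step_cat f2 f1N.
have [D [bD fD sD]] := fin_step_cover fs.
have := @step_int_ge0_in (s2 ++ s1N) 0 D bD fD (fun p ps => (fs p ps).1).
rewrite scale0r add0r -ov_subr_ge0 => ge0.
suff <- : \sum_(p <- s2 ++ s1N) p.1 *: m (D `&` p.2) =
    step_int s2 - step_int s1.
  by apply: ge0 => t _; rewrite add0r step_fun_cat s1NE subr_ge0.
have -> : - step_int s1 = step_int s1N.
  by rewrite /step_int big_map -sumrN; apply: eq_bigr => p _; rewrite scaleNr.
rewrite -step_int_cat /step_int !big_seq; apply: eq_bigr => p /sD pD.
by rewrite setIidr.
Qed.

Lemma step_int_cone (T : set E) s : convex_cone T ->
  (forall A, Borel A -> is_fin (mu A) -> T (m A)) ->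
  fin_step s -> (forall p, p \in s -> 0 <= p.1) -> T (step_int s).
Proof.
move=> [T0 TD TZ] Tm fs s0; rewrite /step_int big_seq.
elim/big_ind : _ => // p ps; apply: TZ; first exact: s0.
by have [bp fp] := fs _ ps; exact: Tm.
Qed.

(* The sets of infinite measure in a simple function with finite integral
   carry the coefficient 0 and can be dropped. *)
Lemma simple_ointegral_step phi x : simple_ointegral mu phi x -> is_fin x ->
  exists s, [/\ fin_step s, forall p, p \in s -> 0 <= p.1,
    phi = step_fun s & x = Fin (step_int s)].
Proof.
move=> [n [r [A [[r0 bA] _ phiE xE]]]] fx.
(* A single infinite term would absorb the whole sum. *)
have term_fin i : is_fin (scale_ext (r i) (mu (A i))).
  apply: contrapT => nfin.
  have scE : scale_ext (r i) (mu (A i)) = Infty.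
    by case: (scale_ext _ _) nfin => [a nfin|//]; case: nfin; exists a.
  move: fx; rewrite xE (bigD1 i) //= scE InftyD => -[a].
  by [].
have pos_fin i : r i != 0 -> is_fin (mu (A i)).
  move=> ri0; have := term_fin i; case: (mu (A i)) => [a _|]; first by exists a.
  by rewrite /= (negbTE ri0).
pose s := [seq (r i, A i) | i <- enum 'I_n & r i != 0].
exists s; split.
- move=> p /mapP[i]; rewrite mem_filter => /andP[/pos_fin fi _] ->.
  by split; [exact (bA i)|].
- by move=> p /mapP[i _ ->]; exact: r0.
- rewrite phiE; apply/funext => t.
  rewrite /step_fun big_map big_filter big_enum_cond.
  rewrite (bigID (fun i => r i != 0)) /= [X in _ + X]big1 ?addr0 // => i.
  by rewrite negbK => /eqP ->; rewrite mul0r.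
- rewrite xE /step_int big_map big_filter big_enum_cond /=.
  have -> : \sum_(i < n | r i != 0) r i *: m (A i) =
      \sum_(i < n) r i *: m (A i).
    rewrite [RHS](bigID (fun i => r i != 0)) /= [X in _ + X]big1 ?addr0 // => i.
    by rewrite negbK => /eqP ->; rewrite scale0r.
  rewrite (big_morph (@Fin E) (id1 := 0) (op1 := +%R)) //.
  apply: eq_bigr => i _.
  (* When [r i] is 0 the set may have infinite measure; the convention for 0 times [Infty] makes
     both sides 0. *)
  have [ri0|/pos_fin[a aE]] := eqVneq (r i) 0; last by rewrite /m aE.
  by rewrite ri0 scale0r; case: (mu (A i)) => [a|] /=; rewrite ?scale0r ?eqxx.
Qed.

End measure.

(** * Dyadic approximation of real numbers *)

Section dyadic.
Context {R : realType}.
Implicit Types (x : R) (n : nat).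

(** Rounding down to a multiple of [2 ^- n], without the usual cap at [n]: it is applied to bounded
    functions. *)
Definition dyadic n x : R := (Num.truncn (2 ^+ n * x))%:R / 2 ^+ n.

Let pow_gt0 n : 0 < (2 : R) ^+ n. Proof. exact: exprn_gt0. Qed.

Lemma dyadic_le n x : 0 <= x -> dyadic n x <= x.
Proof.
move=> x0; rewrite /dyadic ler_pdivrMr // mulrC.
by rewrite truncn_le mulr_ge0 // ltW.
Qed.

Lemma dyadic_gt n x : x < dyadic n x + (2 ^+ n)^-1.
Proof.
rewrite /dyadic -[X in _ + X]mul1r -mulrDl ltr_pdivlMr // mulrC.
by rewrite natr1 truncnS_gt.
Qed.

Let scaled_half (a : R) n : a / 2 ^+ n = 2 * a / 2 ^+ n.+1.
Proof. by rewrite exprS -mulf_div divff // mul1r. Qed.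

Let scaled_double n x : 2 ^+ n.+1 * x = 2 * (2 ^+ n * x).
Proof. by rewrite exprS mulrA. Qed.

(** With [y = 2 ^+ n * x], twice the integer part of [y] is an integer not above [2 * y]. *)
Lemma dyadic_nondecreasing x : 0 <= x -> nondecreasing_seq (dyadic ^~ x).
Proof.
move=> x0; apply/nondecreasing_seqP => n.
have y0 : 0 <= 2 ^+ n * x by rewrite mulr_ge0 // ltW.
rewrite /dyadic scaled_half ler_pM2r ?invr_gt0 // -natrM ler_nat.
rewrite scaled_double truncn_ge_nat ?mulr_ge0 // natrM ler_pM2l //.
by rewrite truncn_le.
Qed.

(** With [y = 2 ^+ n * x] of integer part [k], [2 * y] is less than [2 * (k + 1)], hence so is its
    integer part. *)
Lemma dyadic_upper_nonincreasing x : 0 <= x ->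
  nonincreasing_seq (fun n => dyadic n x + (2 ^+ n)^-1).
Proof.
move=> x0; apply/nonincreasing_seqP => n.
have y0 : 0 <= 2 ^+ n * x by rewrite mulr_ge0 // ltW.
rewrite /dyadic -[X in _ + X <= _]mul1r -[X in _ <= _ + X]mul1r -!mulrDl !natr1.
rewrite (scaled_half _ n) ler_pM2r ?invr_gt0 // -natrM ler_nat.
rewrite scaled_double truncn_lt_nat ?mulr_ge0 // natrM ltr_pM2l //.
exact: truncnS_gt.
Qed.

Lemma dyadic_cvg x : 0 <= x -> dyadic n x @[n --> \oo] --> x.
Proof.
move=> x0; apply: (@squeeze_cvgr _ _ _ _ (fun n => x - (2^-1) ^+ n) (cst x)).
- apply: nearW => n; rewrite dyadic_le // andbT lerBlDr exprVn.
  exact/ltW/dyadic_gt.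
- rewrite -[X in _ --> X]subr0; apply: cvgB; first exact: cvg_cst.
  by apply: cvg_expr; rewrite ger0_norm ?invr_ge0 // invf_lt1 // ltr1n.
- exact: cvg_cst.
Qed.

End dyadic.

(** Since [n + 1 <= 2 ^ n], multiplying the bound by [n + 1] gives [(n + 1) z <= w]. *)
Lemma archimedean_pow2 (R : realType) (E : ovsType R) (z w : E) :
  archimedean_ovs E -> 0 <= w -> (forall n, z <= (2 ^+ n)^-1 *: w) -> z <= 0.
Proof.
move=> archE w0 zw; apply: (archE _ w) => n.
rewrite -scaler_nat; apply: (le_trans (ov_ler_wpZ2l _ (zw n))) => //.
rewrite scalerA -[leRHS]scale1r; apply: ov_ler_wpZ2r => //.
by rewrite ler_pdivrMr ?exprn_gt0 // mul1r -natrX ler_nat ltn_expl.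
Qed.

(** * Continuity of the measure from below *)

Section continuity.
Context {R : realType} {X : topologicalType} {E : ovsType R}.
Variable mu : set X -> ext E.
Hypothesis mu_measure : is_measure mu.

(** The successive differences are disjoint with the same union, and their partial sums telescope to
    [mu (F n)]. *)
Lemma measure_cvg_below (F : nat -> set X) :
  (forall n, Borel (F n)) -> nondecreasing_seq F ->
  supremums (range (fun n => mu (F n))) (mu (\bigcup_n F n)).
Proof.
move=> bF ndF.
have bD n : Borel (seqD F n).
  by case: n => [|n] /=; [exact (bF 0%N)|exact (BorelD (bF n.+1) (bF n))].
have := Defs.measure_sigma_additive mu_measure bD (trivIset_seqD ndF).
rewrite eq_bigcup_seqD.
rewrite (_ : (fun N => _) = (fun n => mu (F n))) //.
apply/funext; elim=> [|n IHn]; first by rewrite big_ord_recl big_ord0 addr0.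
rewrite big_ord_recr /= {}IHn -measure_setU //.
- by rewrite setDUK //; apply/subsetPset/ndF.
- exact (BorelD (bF n.+1) (bF n)).
- by rewrite setDIK.
Qed.

End continuity.

(** * Approximating integrals by step functions *)

Section integral_approximation.
Context {R : realType} {X : topologicalType} {E : ovsType R}.
Variable mu : set X -> ext E.
Hypothesis mu_measure : is_measure mu.
Implicit Types (f : X -> R) (T : set E) (s : seq (R * set X)).

Let m A := fin_part (mu A).

(** A finite value cannot be the default [Infty] of [xget], so it is a genuine integral. *)
Lemma Iint_is_ointegral f x : Iint mu f = x -> is_fin x ->
  is_ointegral mu (EFin \o f) x.
Proof.
by move=> + [a xE]; rewrite xE /Iint /ointegral; case: xgetP => // y yE P [<-].
Qed.

(** The simple functions defining a finite integral have finite integrals themselves, being bounded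
    by it, so these lie in [T]. *)
Lemma Iint_L1pos_seq_up T : convex_cone T ->
  (forall A, Borel A -> is_fin (mu A) -> T (m A)) ->
  Iint mu @` L1pos mu `<=` Fin @` seq_up T.
Proof.
move=> coneT Tm _ [f [bf f0 [a aE]] <-].
have [|phi [s [sphi ndphi _ [ubs lubs]]]] := Iint_is_ointegral aE; first by exists a.
have fs n : is_fin (s n).
  by apply: (is_fin_le (ubs (s n) _)); [exists n|exists a].
have /choice[L LP] n := simple_ointegral_step (sphi n) (fs n).
exists a => //; exists (fun n => step_int mu (L n)); split.
- apply/nondecreasing_seqP => n; apply: step_int_le => //.
  + by have [] := LP n.
  + by have [] := LP n.+1.
  + move=> t; have [_ _ <- _] := LP n; have [_ _ <- _] := LP n.+1.
    exact: ndphi.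
- by move=> n; have [? ? _ _] := LP n; apply: step_int_cone.
- apply/supremums_Fin; first by exists (step_int mu (L 0%N)), 0%N.
  rewrite image_comp (_ : _ @` setT = range s) //.
  by apply: eq_imagel => n _ /=; have [_ _ _ ->] := LP n.
Qed.

Hypothesis mu_fin : is_fin (mu [set: X]).

Let mu_finA A : Borel A -> is_fin (mu A).
Proof. by move=> bA; apply: measure_fin_sub mu_fin => //; exact BorelT. Qed.

Lemma simple_ointegral_fin (phi : X -> R) (x : ext E) :
  simple_ointegral mu phi x -> is_fin x.
Proof.
move=> [n [r [A [[_ bA] _ _ ->]]]]; elim/big_ind : _ => //.
- by exists 0.
- by move=> _ _ [a ->] [b ->]; exists (a + b).
- by move=> i _; have [a ->] := mu_finA (bA i); exists (r i *: a).
Qed.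

Lemma nondecreasing_EFin_cvg (u : nat -> R) (l : R) : nondecreasing_seq u ->
  (u n)%:E @[n --> \oo] --> l%:E ->
  u n @[n --> \oo] --> l /\ forall n, u n <= l.
Proof.
move=> ndu /fine_cvgP[_ cu]; split=> // n.
rewrite -(cvg_lim _ cu) //; apply: nondecreasing_cvgn_le => //.
exact: cvgP cu.
Qed.

(** Removing one term of the list only shifts the threshold by its coefficient on its set. *)
Lemma Borel_sub_step f s c : Borel_measurable f ->
  (forall p, p \in s -> Borel p.2) -> Borel [set t | f t - step_fun s t <= c].
Proof.
move=> bf; elim: s c => [|p s IHs] c bs.
  rewrite (_ : [set t | _] = f @^-1` `]-oo, c]).
    by apply bf; exact: measurable_itv.
  by apply/seteqP; split=> t; rewrite /step_fun /= big_nil subr0 in_itv.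
have bp : Borel p.2 by apply: bs; rewrite mem_head.
have {}bs q : q \in s -> Borel q.2 by move=> qs; apply: bs; rewrite inE qs orbT.
rewrite (_ : [set t | _] =
    (p.2 `&` [set t | f t - step_fun s t <= c + p.1]) `|`
    (~` p.2 `&` [set t | f t - step_fun s t <= c])).
  exact (BorelU (BorelI bp (IHs _ bs)) (BorelI (BorelC bp) (IHs _ bs))).
apply/seteqP; split=> t; rewrite /step_fun /= big_cons.
  have [pt|pt] := pselect (p.2 t).
    by rewrite indicE mem_set // mulr1 => le; left; split=> //; lra.
  by rewrite indicE memNset // mulr0 add0r; right.
move=> [|] [pt]; first by rewrite indicE mem_set // mulr1; lra.
by rewrite indicE memNset // mulr0 add0r.
Qed.

(* Where the approximating simple functions have not yet come within [d] of
   [f] one uses the bound [c] instead; by continuity from below the measure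
   of that set decreases to 0. *)
Lemma step_int_le_ointegral f (a : E) (c d : R) s :
  Borel_measurable f -> (forall t, f t <= c) -> 0 < c -> 0 < d ->
  is_ointegral mu (EFin \o f) (Fin a) ->
  fin_step mu s -> (forall t, step_fun s t <= f t + d) ->
  step_int mu s <= a + (2 * d) *: m setT.
Proof.
move=> bf fc c0 d0 [phi [x [sphi ndphi cvphi [ubx lubx]]]] fs sf.
have /choice[L LP] n := simple_ointegral_step (sphi n)
  (simple_ointegral_fin (sphi n)).
have LE n t : step_fun (L n) t = phi n t by have [_ _ -> _] := LP n.
have cv t := nondecreasing_EFin_cvg (ndphi t) (cvphi t).
pose B n := [set t | f t - step_fun (L n) t <= d].
have bB n : Borel (B n).
  by apply Borel_sub_step => // p; have [fL _ _ _] := LP n; move=> /fL[].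
have ndB : nondecreasing_seq B.
  move=> i j ij; apply/subsetPset => t; rewrite /B /= !LE; apply: le_trans.
  by rewrite lerB //; exact: ndphi.
have BT : \bigcup_n B n = setT.
  apply/seteqP; split=> // t _.
  have [/cvgrPdist_le/(_ d d0) [N _ NP] _] := cv t.
  exists N => //; rewrite /B /= LE (le_trans (ler_norm _)) //.
  exact: NP N (leqnn N).
(* The excess, to be shown at most 0. *)
set z := step_int mu s - (a + (2 * d) *: m setT).
have zle n : z <= c *: m (~` B n).
  have bBn := bB n.
  rewrite /z ov_lerBlDr addrCA.
  have La : step_int mu (L n) <= a.
    by have [_ _ _ xE] := LP n; have := ubx (x n); rewrite xE; apply; exists n.
  (* On [B n] the step function [s] is at most [f + d], hence at most [L n] plus [2 * d]; off [B n]
     it is at most [c + d], and [L n] is positive. *)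
  pose r := [:: (2 * d, [set: X]); (c, ~` B n)].
  have fr : fin_step mu r.
    have bCn := BorelC bBn.
    by move=> p; rewrite !inE => /orP[|] /eqP -> /=; split=> //;
      [exact BorelT|exact: mu_finA].
  have fL : fin_step mu (L n) by have [] := LP n.
  have : step_int mu s <= step_int mu (L n ++ r).
    apply: step_int_le => //; first exact: fin_step_cat.
    move=> t; rewrite step_fun_cat /step_fun !big_cons big_nil /= addr0.
    rewrite -/(step_fun _ _).
    rewrite !indicE in_setT mulr1 in_setC; apply: (le_trans (sf t)).
    have [Bt|Bt] := boolP (t \in B n).
      by move: Bt; rewrite inE /B /= -/(step_fun _ _); lra.
    have [_ L0 _ _] := LP n.
    have : 0 <= step_fun (L n) t.
      by rewrite /step_fun big_seq sumr_ge0 // => p /L0 p0; rewrite mulr_ge0.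
    by have := fc t; rewrite /step_fun /= mulr1; lra.
  move/le_trans; apply.
  rewrite step_int_cat /step_int !big_cons big_nil /= addr0.
  by apply: ov_lerD => //; rewrite addrC.
(* Each [m (B n)] is at most the right-hand side, and their supremum is [m setT]. Cancelling leaves
   [z <= 0]. *)
have : m setT <= m setT - c^-1 *: z.
  have := measure_cvg_below mu_measure bB ndB; rewrite BT => -[_ lub].
  have mTE : mu setT = Fin (m setT) by rewrite /m fin_partK.
  rewrite mTE in lub.
  apply: (lub (Fin (m setT - c^-1 *: z))) => _ [n _ <-].
  rewrite -(fin_partK (mu_finA (bB n))).
  change (m (B n) <= m setT - c^-1 *: z).
  rewrite ov_lerBrDr addrC -ov_lerBrDr.
  rewrite /m (fin_part_split mu_measure BorelT (bB n)) // setTI setTD.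
  rewrite addrAC subrr add0r.
  rewrite -[leRHS]scale1r -(mulVf (lt0r_neq0 c0)) -scalerA.
  by apply: ov_ler_wpZ2l; [rewrite invr_ge0 ltW|exact: zle].
rewrite ov_lerBrDr addrC -ov_lerBrDr subrr => z0.
rewrite -[leLHS](subrK (a + (2 * d) *: m setT)) -/z -[leRHS]add0r.
apply: ovs_lerD2r; rewrite -[z](scalerKV (lt0r_neq0 c0)) -(scaler0 _ c).
by apply: ov_ler_wpZ2l => //; exact: ltW.
Qed.

End integral_approximation.

(** * Bounded functions and finite measures *)

Section bounded.
Context {R : realType} {X : topologicalType} {E : ovsType R}.
Variable mu : set X -> ext E.
Hypothesis mu_measure : is_measure mu.
Implicit Types (f : X -> R) (T : set E).

Let m A := fin_part (mu A).

Lemma dyadic_simple f c n : Borel_measurable f -> (forall t, 0 <= f t <= c) ->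
  exists x, simple_ointegral mu (fun t => dyadic n (f t)) x.
Proof.
(* The integer part of [2 ^+ n * f t] ranges from 0 to that of [2 ^+ n * c] inclusive, whence the
   successor. *)
move=> bf fc; pose N := ((Num.truncn (2 ^+ n * c)).+1)%N.
pose A (k : 'I_N) := [set t | Num.truncn (2 ^+ n * f t) = k].
have q0 : 0 < (2 : R) ^+ n by exact: exprn_gt0.
exists (\sum_(i < N) scale_ext (i%:R / 2 ^+ n) (mu (A i))).
exists N, (fun k => k%:R / 2 ^+ n), A; split=> //.
- split=> k; first by rewrite divr_ge0 // ltW.
  rewrite (_ : A k = f @^-1` `[k%:R / 2 ^+ n, k.+1%:R / 2 ^+ n[).
    by apply bf; exact: measurable_itv.
  have y0 t : 0 <= 2 ^+ n * f t.
    by rewrite mulr_ge0 ?(ltW q0) //; have /andP[] := fc t.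
  apply/seteqP; split=> t; rewrite /A /= in_itv /= ler_pdivrMr // ltr_pdivlMr //.
    by move=> <-; rewrite ![f t * _]mulrC truncn_itv.
  by rewrite ![f t * _]mulrC => ?; exact: truncn_def.
- by move=> i j _ _ [t [/= iE jE]]; apply: val_inj; rewrite /= -iE -jE.
- apply/funext => t.
  have kN : (Num.truncn (2 ^+ n * f t) < N)%N.
    rewrite ltnS le_truncn // ler_pM2l //.
    by have /andP[] := fc t.
  rewrite (bigD1 (Ordinal kN)) //= big1 ?addr0 => [|i ik].
    by rewrite indicE mem_set // mulr1.
  rewrite indicE memNset ?mulr0 // => /esym iE; move: ik.
  by rewrite -val_eqE /= iE eqxx.
Qed.

Lemma Iint_Bpos_seq_down T : archimedean_ovs E -> monotone_complete E ->
  is_fin (mu [set: X]) -> convex_cone T ->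
  (forall A, Borel A -> is_fin (mu A) -> T (m A)) ->
  Iint mu @` Bpos R X `<=` Fin @` seq_down T.
Proof.
move=> archE mcE mu_fin coneT Tm _ [f [bf f0 [M fM]] <-].
(* [step_int_le_ointegral] divides by the bound, and [M] may be 0, or negative if [X] is empty. *)
pose c := `|M| + 1.
have c0 : 0 < c by rewrite ltr_wpDl.
have fc t : f t <= c.
  by rewrite (le_trans (fM t)) // (le_trans (ler_norm _)) // lerDl.
have /choice[x sx] n : exists x, simple_ointegral mu (fun t => dyadic n (f t)) x.
  by apply: (@dyadic_simple f c n bf) => t; rewrite f0 fc.
have /choice[L LP] n := simple_ointegral_step (sx n)
  (simple_ointegral_fin mu_measure mu_fin (sx n)).
have fL n : fin_step mu (L n) by have [] := LP n.
have LE n t : step_fun (L n) t = dyadic n (f t) by have [_ _ <- _] := LP n.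
have fT r : fin_step mu [:: (r, [set: X])].
  by move=> p; rewrite inE => /eqP -> /=; split=> //; exact BorelT.
have TE r t : step_fun [:: (r, [set: X])] t = r.
  by rewrite /step_fun big_seq1 /= indicE in_setT mulr1.
have IE (r : R) : step_int mu [:: (r, [set: X])] = r *: m setT.
  by rewrite /step_int big_seq1.
have ndL : nondecreasing_seq (fun n => step_int mu (L n)).
  move=> i j ij; apply: step_int_le => // t; rewrite !LE.
  exact: dyadic_nondecreasing.
pose u n := step_int mu (L n ++ [:: ((2 ^+ n)^-1, [set: X])]).
have uE n : u n = step_int mu (L n) + (2 ^+ n)^-1 *: m setT.
  by rewrite /u step_int_cat IE.
have fu n : fin_step mu (L n ++ [:: ((2 ^+ n)^-1, [set: X])]).
  exact: fin_step_cat.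
have ufun n t : step_fun (L n ++ [:: ((2 ^+ n)^-1, [set: X])]) t =
    dyadic n (f t) + (2 ^+ n)^-1 by rewrite step_fun_cat LE TE.
(* Completeness gives the dyadic integrals a supremum, so an integral of [f] exists and [xget] does
   not fall back on its default. *)
have [||a0 supa0] := @monotone_complete_sup _ _
  (range (fun n => step_int mu (L n))) mcE.
- split; first by exists (step_int mu (L 0%N)), 0%N.
  move=> _ _ [i _ <-] [j _ <-]; exists (step_int mu (L (maxn i j))).
  by split; [exists (maxn i j)|apply: ndL; rewrite leq_max leqnn ?orbT..].
- exists (step_int mu [:: (c, [set: X])]) => _ [n _ <-].
  apply: step_int_le => // t; rewrite LE TE.
  by apply: le_trans (fc t); exact: dyadic_le.
have : is_ointegral mu (EFin \o f) (Iint mu f).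
  rewrite /Iint /ointegral; apply: (@xgetPex _ Infty); exists (Fin a0).
  exists (fun n t => dyadic n (f t)), x; split=> //.
  - by move=> t; exact: dyadic_nondecreasing.
  - by move=> t; apply: cvg_EFin; [exact: nearW|exact: dyadic_cvg].
  - move/supremums_Fin : supa0; rewrite image_comp.
    rewrite (_ : _ @` setT = range x).
      by apply; exists (step_int mu (L 0%N)), 0%N.
    by apply: eq_imagel => n _ /=; have [_ _ _ ->] := LP n.
(* The value chosen by [xget] may come from another approximating sequence; comparing it with step
   functions from both sides avoids any appeal to uniqueness. *)
move: (Iint mu f) => I intI.
have Ile s : fin_step mu s -> (forall t, f t <= step_fun s t) ->
    (I <= Fin (step_int mu s))%O.
  move=> fs fles; have [phi [y [sphi ndphi cvphi [uby luby]]]] := intI.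
  apply: luby => _ [n _ <-].
  have [l [fl _ phiE ->]] := simple_ointegral_step (sphi n)
    (simple_ointegral_fin mu_measure mu_fin (sphi n)).
  apply: (step_int_le mu_measure fl fs) => t; rewrite -phiE.
  by apply: le_trans (fles t); have [_] := nondecreasing_EFin_cvg (ndphi t) (cvphi t).
have [a IaE] : is_fin I.
  apply: (@is_fin_le _ _ _ (Fin (step_int mu [:: (c, [set: X])]))).
    by apply: Ile => // t; rewrite TE.
  by exists (step_int mu [:: (c, [set: X])]).
rewrite IaE in intI Ile *; exists a => //; exists u; split.
- apply/nonincreasing_seqP => n; apply: step_int_le => // t; rewrite !ufun.
  exact: (dyadic_upper_nonincreasing (f0 t)).
- move=> n; rewrite /u; apply: step_int_cone => // p; rewrite mem_cat => /orP[|].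
    by have [_ L0 _ _] := LP n; exact: L0.
  by rewrite inE => /eqP -> /=; rewrite invr_ge0 exprn_ge0.
- split.
    move=> _ [n _ <-]; apply: (Ile _ (fu n)) => t; rewrite ufun.
    exact/ltW/dyadic_gt.
  move=> y lby.
  have mT0 : 0 <= m setT by apply: fin_part_ge0 => //; exact BorelT.
  suff : y - a <= 0 by rewrite ov_lerBlDr add0r.
  (* The factor 2 is that of the error [2 * d] in [step_int_le_ointegral], with [d] the inverse of
     [2 ^+ n]. *)
  apply: (@archimedean_pow2 _ _ _ (2 *: m setT) archE).
    exact: ovs_scaler_ge0.
  move=> n; rewrite ov_lerBlDr [_ + a]addrC scalerA [_ * 2]mulrC.
  have q0 : 0 < ((2 : R) ^+ n)^-1 by rewrite invr_gt0 exprn_gt0.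
  apply: (le_trans (lby (u n) _)); first by exists n.
  apply: (step_int_le_ointegral mu_measure mu_fin bf fc c0 q0 intI (fu n)) => t.
  by rewrite ufun lerD2r dyadic_le.
Qed.

End bounded.

(** * Regularity as a limit along directed sets *)

Section regular.
Context {R : realType} {X : topologicalType} {E : ovsType R}.
Variable mu : set X -> ext E.
Hypothesis mu_measure : is_measure mu.

(** Open supersets are stable under intersection, so their finite measures are directed downwards;
    discarding infinite values does not change the infimum. *)
Lemma outer_regular_net_down (S : set E) A : Borel A -> is_fin (mu A) ->
  outer_regular mu A ->
  (forall V, open V -> is_fin (mu V) -> S (fin_part (mu V))) ->
  net_down S (fin_part (mu A)).
Proof.
move=> bA fA [lbA glbA] Sopen.
pose D := [set v | exists V, [/\ open V, A `<=` V & mu V = Fin v]].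
have aE := fin_partK fA.
apply: (@net_downW _ _ D).
- split.
    have [[v vE]|noV] := pselect (exists v, D v); first by exists v.
    (* If all open supersets had infinite measure, so would [A] by outer regularity. *)
    exfalso; have : (Infty <= mu A)%O; last by rewrite -aE.
    apply: glbA => _ [V [oV AV] <-].
    by case vE : (mu V) => [v|] //; case: noV; exists v, V.
  move=> v w [V [oV AV vE]] [W [oW AW wE]].
  have bV := open_Borel oV; have bW := open_Borel oW.
  have bVW := BorelI bV bW.
  have VW_V : (mu (V `&` W) <= Fin v)%O.
    by rewrite -vE; apply: measure_le => //; exact: subIsetl.
  have VW_W : (mu (V `&` W) <= Fin w)%O.
    by rewrite -wE; apply: measure_le => //; exact: subIsetr.
  have [z zE] : is_fin (mu (V `&` W)) by apply: is_fin_le VW_V _; exists v.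
  rewrite zE in VW_V VW_W; exists z; split=> //.
  by exists (V `&` W); split=> //; [exact: openI|move=> t At; split; auto].
- move=> v [V [oV AV vE]]; have := Sopen V oV; rewrite vE; apply.
  by exists v.
- split.
    move=> v [V [oV AV vE]].
    have : (Fin (fin_part (mu A)) <= Fin v)%O.
      by rewrite aE -vE; apply: lbA; exists V.
    by [].
  move=> y lby; have : (Fin y <= mu A)%O; last by rewrite -[in X in X -> _]aE.
  apply: glbA => _ [V [oV AV] <-].
  by case vE : (mu V) => [v|] //; apply: lby; exists V.
Qed.

(** Compact subsets are stable under union, so their measures are directed upwards. The Hausdorff
    property makes compact sets closed, hence Borel. *)
Lemma inner_regular_net_up (S : set E) A : hausdorff_space X -> Borel A ->
  is_fin (mu A) -> inner_regular mu A ->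
  (forall K, compact K -> is_fin (mu K) /\ S (fin_part (mu K))) ->
  net_up S (fin_part (mu A)).
Proof.
move=> hausX bA fA [ubA lubA] Scpt; have aE := fin_partK fA.
have bK (K : set X) : compact K -> Borel K.
  move=> cK; rewrite -[K]setCK; apply BorelC; apply open_Borel.
  by rewrite openC; exact: compact_closed.
pose D := [set v | exists K, [/\ compact K, K `<=` A & mu K = Fin v]].
apply/net_upP; exists D; split.
- split.
    exists (fin_part (mu set0)), set0; split; [exact: compact0|by []|].
    by rewrite fin_partK //; have [] := Scpt _ compact0.
  move=> v w [K [cK KA vE]] [J [cJ JA wE]].
  have cKJ : compact (K `|` J) by exact: (@compactU X K J cK cJ).
  have bKJ := bK _ cKJ; have [[z zE] _] := Scpt _ cKJ.
  exists z; split.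
  + by exists (K `|` J); split=> // t [/KA|/JA].
  + have : (Fin v <= Fin z)%O; last by [].
    by rewrite -vE -zE; apply: measure_le => //; exact (bK _ cK).
  + have : (Fin w <= Fin z)%O; last by [].
    by rewrite -wE -zE; apply: measure_le => //; exact (bK _ cJ).
- by move=> v [K [cK KA vE]]; have [_] := Scpt _ cK; rewrite vE.
- split.
    move=> v [K [cK KA vE]].
    have : (Fin v <= Fin (fin_part (mu A)))%O; last by [].
    by rewrite aE -vE; apply: ubA; exists K.
  move=> y uby; have : (mu A <= Fin y)%O; last by rewrite -[in X in X -> _]aE.
  apply: lubA => _ [K [cK KA] <-].
  have [[v vE] _] := Scpt _ cK; rewrite vE.
  by apply: uby; exists K.
Qed.

End regular.

Unset Implicit Arguments.

(** * The four inclusions *)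

Theorem proposition5p6 (R : realType) (X : topologicalType) (E : ovsType R)
    (pi : {linear Cc X R -> E}) (mu : set X -> ext E)
    (hausX : hausdorff_space X) (lcX : locally_compact [set: X])
    (archE : archimedean_ovs E) (mcE : monotone_complete E)
    (pi_ge0 : forall f : Cc X R, (forall t, 0 <= f t) -> 0 <= pi f)
    (mu_reg : is_regular_Borel_measure mu)
    (pi_int : forall f : Cc X R, real_ointegral mu f (pi f))
    (mu_open : forall V : set X, open V -> is_fin (mu V) ->
       exists2 v, mu V = Fin v & sup_in (pos_cone E) (pi @` below_set R V) v)
    (mu_compact : forall K : set X, compact K ->
       exists2 k, mu K = Fin k & inf_in (pos_cone E) (pi @` above_set R K) k) :
  let S := pi @` Cc_pos X R in
  [/\ Iint mu @` L1pos mu `<=` Fin @` seq_up (net_down (net_up S)),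
      (forall A, Borel A -> is_fin (mu A) -> inner_regular mu A) ->
        Iint mu @` L1pos mu `<=` Fin @` seq_up (net_up (net_down S)) &
      is_fin (mu setT) ->
        Iint mu @` Bpos R X `<=` Fin @` seq_down (net_down (net_up S)) /\
        ((forall A, Borel A -> inner_regular mu A) ->
           Iint mu @` Bpos R X `<=` Fin @` seq_down (net_up (net_down S)))].
Proof.
move=> S; have mu_measure := regular_measure mu_reg.
have coneS : convex_cone S by exact: positive_operator_cone.
have coneDU := net_down_cone (net_up_cone coneS).
have coneUD := net_up_cone (net_down_cone coneS).
have muDU A : Borel A -> is_fin (mu A) -> net_down (net_up S) (fin_part (mu A)).
  move=> bA fA; apply: outer_regular_net_down => //.
    exact: (regular_outer mu_reg).
  move=> V oV fV; have [v -> supv] := mu_open V oV fV.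
  exact: below_set_net_up supv.
have muUD A : Borel A -> is_fin (mu A) -> inner_regular mu A ->
    net_up (net_down S) (fin_part (mu A)).
  move=> bA fA rA; apply: inner_regular_net_up => // K cK.
  have [k -> infk] := mu_compact K cK; split; first by exists k.
  (* Local compactness provides a function above [K], so the family is non-empty, as directedness
     requires. *)
  by apply: above_set_net_down infk => //; exact: above_set_nonempty.
split.
- exact: Iint_L1pos_seq_up.
- move=> rA; apply: Iint_L1pos_seq_up => // A bA fA.
  by apply: muUD => //; exact: rA.
- move=> mu_fin; split; first exact: Iint_Bpos_seq_down.
  move=> rA; apply: Iint_Bpos_seq_down => // A bA fA.
  by apply: muUD => //; exact: rA.
Qed.
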